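(* Let $m>0$, and let $R(t)$ be a real analytic function (with Taylor series convergent in the entire complex plane) that is the shoreline run-up of a solution $(\eta,u)$ of the dimensionless shallow water equations in the power-shaped bay with parameter $m$. Assume that the Carrier–Greenspan transformation is invertible (the wave does not break). Consider the pressure at the shoreline $$\psi(0,\tau)=R(t)+\tfrac12\big(\partial_tR(t)\big)^2,\qquad\text{where } t=\tau+\varphi(0,\tau)=\tau-\partial_tR(t).$$ Then the even component (in $\tau$) of $\psi(0,\tau)$ depends only on the initial pressure $\psi(\cdot,0)$ of the wave, and the odd component (in $\tau$) of $\psi(0,\tau)$ depends only on the initial velocity $\varphi(\cdot,0)$ of the wave. That is, if $(\psi_1,\varphi_1)$ and $(\psi_2,\varphi_2)$ arise in this way (with the same $m$) and $\psi_1(\sigma,0)=\psi_2(\sigma,0)$ for all $\sigma\ge0$, then $[\psi_1(0,\tau)]_{\rm even}=[\psi_2(0,\tau)]_{\rm even}$ for all $\tau\in\mathbb{R}$; and if $\varphi_1(\sigma,0)=\varphi_2(\sigma,0)$ for all $\sigma\ge 0$, then $[\psi_1(0,\tau)]_{\rm odd}=[\psi_2(0,\tau)]_{\rm odd}$ for all $\tau\in\mathbb{R}$.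
   Context: The dimensionless 1D shallow water equations in an inclined power-shaped bay $z(x,y)=-x+|y|^m$ with bay parameter $m>0$ are $$\partial_t\eta+u\,\partial_x(x+\eta)+\tfrac{m}{m+1}(x+\eta)\,\partial_x u=0,\qquad \partial_t u+u\,\partial_x u+\partial_x\eta=0,$$ where $\eta(x,t)$ is the water displacement and $u(x,t)$ the cross-section averaged velocity, considered on the wet region $x+\eta(x,t)\ge 0$; the shoreline is the free boundary $x+\eta(x,t)=0$. The (vertical) run-up $R(t)$ is the value of $\eta$ at the shoreline at time $t$; at the shoreline $u=-\partial_tR(t)$. The Carrier–Greenspan transformation (CGT) introduces $$\sigma=x+\eta(x,t),\quad \tau=t-u(x,t),\quad \varphi(\sigma,\tau)=u(x,t),\quad \psi(\sigma,\tau)=\eta(x,t)+\tfrac12u(x,t)^2 .$$ It is assumed invertible: $(x,t)\mapsto(\sigma,\tau)$ is one-to-one with non-vanishing Jacobians, from the wet region onto $\{\sigma\ge0,\ \tau\in\mathbb{R}\}$. The shoreline corresponds to $\sigma=0$, where $$\tau=t+\partial_tR(t),\quad \varphi(0,\tau)=-\partial_tR(t),\quad \psi(0,\tau)=R(t)+\tfrac12(\partial_tR(t))^2 .$$ Under the CGT the shallow water equations become the linear hyperbolic system $$\partial_\tau\psi+\tfrac{m}{m+1}\,\sigma\,\partial_\sigma\varphi+\varphi=0,\qquad \partial_\tau\varphi+\partial_\sigma\psi=0 ,\qquad \sigma\ge0,\ \tau\in\mathbb{R}.$$ Solutions $\psi,\varphi$ are assumed smooth on $[0,\infty)\times\mathbb{R}$,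 up to and including $\sigma=0$. ''Initial pressure'' and ''initial velocity'' refer to the hodograph-plane data $\psi(\sigma,0)$ and $\varphi(\sigma,0)$ on the line $\tau=0$. For a function $f$ on $\mathbb{R}$, $[f(\tau)]_{\rm even}=\tfrac12(f(\tau)+f(-\tau))$ and $[f(\tau)]_{\rm odd}=\tfrac12(f(\tau)-f(-\tau))$. *)

(* Defs.v *)
(* Stdlib reals with Coquelicot. *)
From Stdlib Require Import Reals.
From Coquelicot Require Import Coquelicot.
Open Scope R_scope.

(* [f] is differentiable at (x, y) relative to the set [D], with first and
   second partial derivatives [fx] and [fy]; the derivative is one-sided at
   points of [D] on its boundary, and [f] is not looked at outside [D]. *)
Definition has_partials_on (D : R -> R -> Prop) (f : R -> R -> R)
    (x y fx fy : R) : Prop :=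
  filterdiff (fun p : R * R => f (fst p) (snd p))
    (within (fun p : R * R => D (fst p) (snd p)) (locally (x, y)))
    (fun v : R * R => fst v * fx + snd v * fy).

(* C^infinity on [D], including the points of [D] on its boundary:
   [d i j] is the derivative of order i in the first variable and j in the
   second. *)
Definition smooth_on (D : R -> R -> Prop) (f : R -> R -> R) : Prop :=
  exists d : nat -> nat -> R -> R -> R,
    (forall x y, D x y -> d 0%nat 0%nat x y = f x y) /\
    (forall i j x y, D x y ->
       has_partials_on D (d i j) x y (d (S i) j x y) (d i (S j) x y)).

(* Analytic on the line, with a Taylor series convergent on all of C. *)
Definition entire (r : R -> R) : Prop :=
  exists a : nat -> R, CV_radius a = p_infty /\ forall t, r t = PSeries a t.

(* The fields eta and u are total functions of which only the values on the
   wet region are meaningful. *)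
Definition wet (eta : R -> R -> R) (x t : R) : Prop := 0 <= x + eta x t.

Definition swe_solution (m : R) (eta u : R -> R -> R) : Prop :=
  forall x t, wet eta x t ->
  exists eta_x eta_t u_x u_t : R,
    has_partials_on (wet eta) eta x t eta_x eta_t /\
    has_partials_on (wet eta) u x t u_x u_t /\
    eta_t + u x t * (1 + eta_x) + m / (m + 1) * (x + eta x t) * u_x = 0 /\
    u_t + u x t * u_x + eta_x = 0.

(* The shoreline x + eta = 0 is the free boundary: the other points of the wet
   region are interior to it.  As eta is a total function, this has to be
   required; otherwise its values outside the wet region could make that region
   have isolated points, where partial derivatives are arbitrary. *)
Definition free_boundary (eta : R -> R -> R) : Prop :=
  forall x t, 0 < x + eta x t ->
    locally (x, t) (fun p : R * R => wet eta (fst p) (snd p)).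

Definition is_runup (eta : R -> R -> R) (r : R -> R) : Prop :=
  forall t, (exists x, x + eta x t = 0) /\
            (forall x, x + eta x t = 0 -> eta x t = r t).

Definition cg_sigma (eta : R -> R -> R) (x t : R) : R := x + eta x t.
Definition cg_tau (u : R -> R -> R) (x t : R) : R := t - u x t.

Definition half_plane (sigma tau : R) : Prop := 0 <= sigma.

(* (x, t) |-> (sigma, tau) is a bijection from the wet region onto the half
   plane with a Jacobian that does not vanish, shoreline included (the wet
   region is mapped into the half plane by definition). *)
Definition cgt_invertible (eta u : R -> R -> R) : Prop :=
  (forall x t x' t', wet eta x t -> wet eta x' t' ->
     cg_sigma eta x t = cg_sigma eta x' t' -> cg_tau u x t = cg_tau u x' t' ->
     x = x' /\ t = t') /\
  (forall sigma tau, half_plane sigma tau ->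
     exists x t, wet eta x t /\ cg_sigma eta x t = sigma /\ cg_tau u x t = tau) /\
  (forall x t, wet eta x t ->
     forall sigma_x sigma_t tau_x tau_t : R,
     has_partials_on (wet eta) (cg_sigma eta) x t sigma_x sigma_t ->
     has_partials_on (wet eta) (cg_tau u) x t tau_x tau_t ->
     sigma_x * tau_t - sigma_t * tau_x <> 0).

Definition cgt_image (eta u psi phi : R -> R -> R) : Prop :=
  forall x t, wet eta x t ->
    phi (cg_sigma eta x t) (cg_tau u x t) = u x t /\
    psi (cg_sigma eta x t) (cg_tau u x t) = eta x t + (u x t) ^ 2 / 2.

(* (eta, u) is a non-breaking solution of the shallow water equations in the bay
   with parameter m, r is its run-up, and (psi, phi) is its image under the
   Carrier-Greenspan transformation.  The linear system for (psi, phi) and the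
   relation u = - r' on the shoreline are consequences and not part of the
   definition. *)
Definition nonbreaking_wave (m : R) (eta u : R -> R -> R) (r : R -> R)
    (psi phi : R -> R -> R) : Prop :=
  swe_solution m eta u /\ free_boundary eta /\
  is_runup eta r /\ entire r /\
  cgt_invertible eta u /\ cgt_image eta u psi phi /\
  smooth_on half_plane psi /\ smooth_on half_plane phi.

Definition even_part (f : R -> R) (tau : R) : R := (f tau + f (- tau)) / 2.
Definition odd_part (f : R -> R) (tau : R) : R := (f tau - f (- tau)) / 2.

(* Main.v *)
Require Import Defs.
From Stdlib Require Import Reals Lra Psatz ClassicalEpsilon.
From Coquelicot Require Import Coquelicot.
Open Scope R_scope.

(* The linear system is invariant under (psi, phi)(sigma, tau) |->
   (psi, - phi)(sigma, - tau), so twice the even (odd) part in tau of psi is the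
   first component of a solution whose data at tau = 0 are 2 psi and 0 (0 and
   2 phi).  Hence everything reduces to uniqueness at sigma = 0 for zero data,
   which follows from the conservation law
     d/dtau [sigma^(1/m) (psi^2 + c sigma phi^2)]
       + d/dsigma [2 c sigma^(1 + 1/m) psi phi] = 0,   c = m / (m + 1),
   integrated over a cone [e L, L] with L = b - lam tau: with lam^2 >= b nothing
   enters through the fast outer side, and the inner side contributes O(e).
   Integrating from e L rather than from 0 avoids the singular weight at the
   shoreline.
   At the shoreline, differentiating r(t) = eta(- r(t), t) and comparing with the
   first equation gives (1 + eta_x) (u + r') = 0, and 1 + eta_x <> 0 because
   otherwise the Jacobian would vanish. *)

(** * Differentiability relative to a set, and C1 functions of two variables *)

(* [g] is the affine approximation outside [D]; it brings derivatives relative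
   to [D] back to ordinary differentiability. *)
Lemma has_partials_on_extension (D : R -> R -> Prop) (f : R -> R -> R)
    (x y fx fy : R) :
  D x y -> has_partials_on D f x y fx fy ->
  exists g : R -> R -> R,
    (forall u v, D u v -> g u v = f u v) /\ differentiable_pt_lim g x y fx fy.
Proof.
  intros HD [_ H].
  exists (fun u v => if excluded_middle_informative (D u v) then f u v
                     else f x y + (fx * (u - x) + fy * (v - y))).
  split.
  { intros u v Huv. destruct (excluded_middle_informative (D u v)); tauto. }
  intros eps.
  (* [filterdiff] measures the increment in the Euclidean norm of [R * R], which is at most twice
     the maximum norm of [differentiable_pt_lim]; hence half of [eps]. *)
  assert (He2 : 0 < eps / 2) by (destruct eps; simpl; lra).
  assert (Hlim : is_filter_lim
      (within (fun p : R * R => D (fst p) (snd p)) (locally (x, y))) (x, y)).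
  { intros P HP. unfold within.
    apply filter_imp with (2 := HP); auto. }
  specialize (H (x, y) Hlim (mkposreal _ He2)).
  unfold within in H.
  destruct H as [d H]; exists d; intros u v Hu Hv.
  specialize (H (u, v) (conj Hu Hv)).
  destruct (excluded_middle_informative (D x y)) as [_|]; [|tauto].
  assert (Hm : 0 <= Rmax (Rabs (u - x)) (Rabs (v - y))).
  { eapply Rle_trans; [apply Rabs_pos | apply Rmax_l]. }
  destruct (excluded_middle_informative (D u v)) as [Huv|].
  - specialize (H Huv). simpl in H.
    assert (Hn : norm (minus (u, v) (x, y) : R * R)
                 <= 2 * Rmax (Rabs (u - x)) (Rabs (v - y))).
    { unfold norm, minus, plus, opp; simpl.
      unfold prod_norm, norm; simpl.
      apply Rle_trans with
        (Rabs (u - x) + Rabs (v - y)).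
      - unfold abs, plus, opp; simpl.
        replace (Rabs (u - x) + Rabs (v - y))
          with (sqrt ((Rabs (u - x) + Rabs (v - y)) * (Rabs (u - x) + Rabs (v - y)))).
        + apply sqrt_le_1_alt.
          generalize (Rabs_pos (u - x)) (Rabs_pos (v - y)); unfold Rminus; nra.
        + apply sqrt_square.
          generalize (Rabs_pos (u - x)) (Rabs_pos (v - y)); lra.
      - generalize (Rmax_l (Rabs (u - x)) (Rabs (v - y)))
          (Rmax_r (Rabs (u - x)) (Rabs (v - y))); lra. }
    unfold minus, plus, opp, norm at 1 in H; simpl in H.
    unfold abs in H; simpl in H.
    replace (fx * (u - x) + fy * (v - y))
      with ((u + - x) * fx + (v + - y) * fy) by ring.
    eapply Rle_trans; [exact H|].
    unfold norm in Hn; simpl in Hn.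
    unfold minus, plus, opp in Hn; simpl in Hn.
    unfold norm; simpl.
    eapply Rle_trans; [apply Rmult_le_compat_l; [lra| exact Hn]|].
    lra.
  - match goal with |- Rabs ?a <= _ => replace a with 0 by ring end.
    rewrite Rabs_R0. apply Rmult_le_pos; [destruct eps; simpl; lra | exact Hm].
Qed.

(** Compactness supplies a uniform lower bound for a gauge, not an upper bound for [f]. The gauge at
    each point is therefore kept below [/ (1 + Rabs (f x y))], so that a lower bound for it is an
    upper bound for [f]. *)
Lemma continuity_2d_pt_bounded (f : R -> R -> R) (a b a' b' : R) :
  (forall x y, a <= x <= b -> a' <= y <= b' -> continuity_2d_pt f x y) ->
  exists M, 0 <= M /\
    forall x y, a <= x <= b -> a' <= y <= b' -> Rabs (f x y) <= M.
Proof.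
  intros Hf.
  assert (Hex : forall x y, exists d : posreal,
    a <= x <= b -> a' <= y <= b' ->
    d <= / (1 + Rabs (f x y)) /\
    (forall u v, Rabs (u - x) < d -> Rabs (v - y) < d ->
       Rabs (f u v - f x y) < 1)).
  { intros x y.
    destruct (excluded_middle_informative (a <= x <= b /\ a' <= y <= b'))
      as [[Hx Hy]|Hn].
    - destruct (Hf x y Hx Hy (mkposreal 1 Rlt_0_1)) as [d Hd].
      assert (Hp : 0 < / (1 + Rabs (f x y))).
      { apply Rinv_0_lt_compat; generalize (Rabs_pos (f x y)); lra. }
      assert (Hm : 0 < Rmin d (/ (1 + Rabs (f x y)))).
      { apply Rmin_pos; [apply cond_pos | exact Hp]. }
      exists (mkposreal _ Hm). intros _ _; simpl. split; [apply Rmin_r|].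
      intros u v Hu Hv. apply Hd; eapply Rlt_le_trans; eauto; apply Rmin_l.
    - exists (mkposreal 1 Rlt_0_1). tauto. }
  pose (delta := fun x y => proj1_sig (constructive_indefinite_description _ (Hex x y))).
  destruct (compactness_value_2d a b a' b' delta) as [d Hd].
  assert (Hdi : 0 < / d) by (apply Rinv_0_lt_compat, cond_pos).
  exists (1 + / d). split; [lra|].
  intros x y Hx Hy.
  (* [compactness_value_2d] yields its tagged point (u, v) only under a double negation. *)
  apply NNPP; intro Hneg. apply (Hd x y Hx Hy). intros (u & v & Hu & Hv & H1 & H2 & H3).
  apply Hneg.
  unfold delta in *. destruct (constructive_indefinite_description _ (Hex u v)) as [e He].
  simpl in *. destruct (He Hu Hv) as [H4 H5].
  specialize (H5 x y H1 H2).
  assert (H6 : 1 + Rabs (f u v) <= / d).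
  { rewrite <- (Rinv_inv (1 + Rabs (f u v))).
    apply Rinv_le_contravar; [apply cond_pos | lra]. }
  replace (f x y) with ((f x y - f u v) + f u v) by ring.
  eapply Rle_trans; [apply Rabs_triang | lra].
Qed.

(** The open half plane is used because the weight s^(1/m) of the energy is not differentiable at s
    = 0 when m > 1. *)
Definition C1_pos (f fs ft : R -> R -> R) : Prop :=
  forall s t, 0 < s ->
    differentiable_pt_lim f s t (fs s t) (ft s t) /\
    continuity_2d_pt fs s t /\ continuity_2d_pt ft s t.

Lemma C1_pos_continuity_2d_pt (f fs ft : R -> R -> R) (s t : R) :
  C1_pos f fs ft -> 0 < s -> continuity_2d_pt f s t.
Proof.
  intros H Hs. apply differentiable_continuity_pt.
  exists (fs s t), (ft s t). apply H, Hs.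
Qed.

Lemma differentiable_pt_lim_eq (f : R -> R -> R) (x y a b a' b' : R) :
  differentiable_pt_lim f x y a b -> a = a' -> b = b' ->
  differentiable_pt_lim f x y a' b'.
Proof. intros H <- <-; exact H. Qed.

Lemma differentiable_pt_lim_plus (f g : R -> R -> R) (x y fx fy gx gy : R) :
  differentiable_pt_lim f x y fx fy -> differentiable_pt_lim g x y gx gy ->
  differentiable_pt_lim (fun u v => f u v + g u v) x y (fx + gx) (fy + gy).
Proof.
  intros Hf Hg.
  assert (H : differentiable_pt_lim Rplus (f x y) (g x y) 1 1).
  { intros eps. exists (mkposreal 1 Rlt_0_1). intros u v _ _.
    match goal with |- Rabs ?a <= _ => replace a with 0 by ring end.
    rewrite Rabs_R0. apply Rmult_le_pos; [apply Rlt_le, cond_pos|].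
    eapply Rle_trans; [apply Rabs_pos | apply Rmax_l]. }
  eapply differentiable_pt_lim_eq.
  - exact (differentiable_pt_lim_comp _ _ _ _ _ _ _ _ _ _ _ H Hf Hg).
  - ring.
  - ring.
Qed.

Lemma differentiable_pt_lim_mult (f g : R -> R -> R) (x y fx fy gx gy : R) :
  differentiable_pt_lim f x y fx fy -> differentiable_pt_lim g x y gx gy ->
  differentiable_pt_lim (fun u v => f u v * g u v) x y
    (fx * g x y + f x y * gx) (fy * g x y + f x y * gy).
Proof.
  intros Hf Hg.
  assert (H : differentiable_pt_lim Rmult (f x y) (g x y) (g x y) (f x y)).
  { intros eps. exists eps. intros u v Hu Hv.
    match goal with |- Rabs ?a <= _ =>
      replace a with ((u - f x y) * (v - g x y)) by ring end.
    rewrite Rabs_mult.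
    apply Rmult_le_compat; try apply Rabs_pos; [lra | apply Rmax_r]. }
  eapply differentiable_pt_lim_eq.
  - exact (differentiable_pt_lim_comp _ _ _ _ _ _ _ _ _ _ _ H Hf Hg).
  - ring.
  - ring.
Qed.

Lemma C1_pos_plus (f fs ft g gs gt : R -> R -> R) :
  C1_pos f fs ft -> C1_pos g gs gt ->
  C1_pos (fun s t => f s t + g s t) (fun s t => fs s t + gs s t)
         (fun s t => ft s t + gt s t).
Proof.
  intros Hf Hg s t Hs. destruct (Hf s t Hs) as (?&?&?), (Hg s t Hs) as (?&?&?).
  split; [|split].
  - now apply differentiable_pt_lim_plus.
  - now apply continuity_2d_pt_plus.
  - now apply continuity_2d_pt_plus.
Qed.

Lemma C1_pos_mult (f fs ft g gs gt : R -> R -> R) :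
  C1_pos f fs ft -> C1_pos g gs gt ->
  C1_pos (fun s t => f s t * g s t) (fun s t => fs s t * g s t + f s t * gs s t)
         (fun s t => ft s t * g s t + f s t * gt s t).
Proof.
  intros Hf Hg s t Hs.
  assert (Cf := C1_pos_continuity_2d_pt _ _ _ s t Hf Hs).
  assert (Cg := C1_pos_continuity_2d_pt _ _ _ s t Hg Hs).
  destruct (Hf s t Hs) as (?&?&?), (Hg s t Hs) as (?&?&?).
  split; [|split].
  - now apply differentiable_pt_lim_mult.
  - now apply continuity_2d_pt_plus; apply continuity_2d_pt_mult.
  - now apply continuity_2d_pt_plus; apply continuity_2d_pt_mult.
Qed.

Lemma C1_pos_fst (h dh : R -> R) :
  (forall s, 0 < s -> is_derive h s (dh s) /\ continuity_pt dh s) ->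
  C1_pos (fun s _ => h s) (fun s _ => dh s) (fun _ _ => 0).
Proof.
  intros H s t Hs. destruct (H s Hs) as [H1 H2].
  split; [|split].
  - apply differentiable_pt_lim_proj1_0, is_derive_Reals, H1.
  - apply continuity_1d_2d_pt_comp; [exact H2 | apply continuity_2d_pt_id1].
  - apply continuity_2d_pt_const.
Qed.

Lemma is_derive_comp_2d (f : R -> R -> R) (g h : R -> R) (x fx fy dg dh : R) :
  differentiable_pt_lim f (g x) (h x) fx fy ->
  is_derive g x dg -> is_derive h x dh ->
  is_derive (fun z => f (g z) (h z)) x (fx * dg + fy * dh).
Proof.
  intros Hf Hg Hh. apply is_derive_Reals.
  apply derivable_pt_lim_comp_2d; [exact Hf | |]; now apply is_derive_Reals.
Qed.

(** * The energy estimate on a shrinking cone *)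

(** With L(t) = b - lam t, the substitution s = x L(t) turns the integral of P over the moving
    interval [e L, L] into one over the fixed interval [e, 1]; the function differentiated here is
    its integrand. *)
Lemma is_derive_cone_density (P Ps Pt : R -> R -> R) (b lam x t : R) :
  C1_pos P Ps Pt -> 0 < x -> 0 < b - lam * t ->
  is_derive (fun z => (b - lam * z) * P (x * (b - lam * z)) z) t
    (- lam * P (x * (b - lam * t)) t +
     (b - lam * t) * (Ps (x * (b - lam * t)) t * (- lam * x) + Pt (x * (b - lam * t)) t)).
Proof.
  intros HP Hx HL.
  assert (Hs : 0 < x * (b - lam * t)) by now apply Rmult_lt_0_compat.
  evar_last.
  - apply (is_derive_mult (fun z => b - lam * z) (fun z => P (x * (b - lam * z)) z) t (- lam)).
    + auto_derive; [trivial | ring].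
    + apply (is_derive_comp_2d P (fun z => x * (b - lam * z)) (fun z => z) t
        _ _ (- lam * x) 1 (proj1 (HP _ t Hs))).
      * auto_derive; [trivial | ring].
      * apply (is_derive_id t).
    + intros; apply Rmult_comm.
  - unfold plus, mult; simpl; ring.
Qed.

Lemma cone_region_open (b lam x t : R) :
  0 < x -> 0 < b - lam * t ->
  locally_2d (fun z y => 0 < y /\ 0 < b - lam * z) t x.
Proof.
  intros Hx HL.
  (* The second radius gives |lam (z - t)| < b - lam t; the summand 1 covers lam = 0. *)
  assert (Hd : 0 < Rmin x ((b - lam * t) / (1 + Rabs lam))).
  { apply Rmin_pos; [exact Hx|]. apply Rdiv_lt_0_compat; [exact HL|].
    generalize (Rabs_pos lam); lra. }
  exists (mkposreal _ Hd); simpl. intros z y Hz Hy.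
  assert (Hy' := Rlt_le_trans _ _ _ Hy (Rmin_l _ _)).
  assert (Hz' := Rlt_le_trans _ _ _ Hz (Rmin_r _ _)).
  split. { apply Rabs_def2 in Hy'; lra. }
  assert (H1 : Rabs (lam * (z - t)) < b - lam * t).
  { rewrite Rabs_mult.
    apply Rmult_lt_compat_r with (r := 1 + Rabs lam) in Hz';
      [|generalize (Rabs_pos lam); lra].
    unfold Rdiv in Hz'. rewrite Rmult_assoc, Rinv_l, Rmult_1_r in Hz';
      [|generalize (Rabs_pos lam); lra].
    generalize (Rabs_pos (z - t)); lra. }
  apply Rabs_def2 in H1; lra.
Qed.

Lemma continuity_2d_pt_cone (f : R -> R -> R) (b lam x t : R) :
  continuity_2d_pt f (x * (b - lam * t)) t ->
  continuity_2d_pt (fun z y => f (y * (b - lam * z)) z) t x.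
Proof.
  intros Hf eps. destruct (Hf eps) as [d Hd].
  assert (H1 : continuity_2d_pt (fun z y => y * (b - lam * z)) t x).
  { apply continuity_2d_pt_mult; [apply continuity_2d_pt_id2|].
    apply continuity_2d_pt_minus; [apply continuity_2d_pt_const|].
    apply continuity_2d_pt_mult; [apply continuity_2d_pt_const|].
    apply continuity_2d_pt_id1. }
  destruct (H1 d) as [d1 Hd1].
  assert (Hm : 0 < Rmin d d1) by (apply Rmin_pos; apply cond_pos).
  exists (mkposreal _ Hm); simpl; intros u v Hu Hv.
  apply Hd.
  - apply Hd1; eapply Rlt_le_trans; eauto; apply Rmin_r.
  - eapply Rlt_le_trans; [exact Hu | apply Rmin_l].
Qed.

Lemma continuous_2d_snd (f : R -> R -> R) (t x : R) :
  continuity_2d_pt f t x -> continuous (f t) x.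
Proof.
  intros H. apply continuity_pt_filterlim. intros eps Heps.
  destruct (H (mkposreal eps Heps)) as [d Hd].
  exists d. split; [apply cond_pos|]. intros y [_ Hy].
  apply Hd; [|exact Hy].
  replace (t - t) with 0 by ring. rewrite Rabs_R0. apply cond_pos.
Qed.

(** Transport theorem on the cone: the law P_t + F_s = 0 makes the time derivative of the integrand
    an exact x-derivative. What remains is the flux through the outer side s = L and the inner side
    s = e L, which move with velocities - lam and - lam e. *)
Lemma conservation_law_cone (P Ps Pt F Fs Ft : R -> R -> R) (b lam e t : R) :
  C1_pos P Ps Pt -> C1_pos F Fs Ft ->
  (forall s z, 0 < s -> Pt s z = - Fs s z) ->
  0 < e <= 1 -> 0 < b - lam * t ->
  is_derive
    (fun z => RInt (fun x => (b - lam * z) * P (x * (b - lam * z)) z) e 1) t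
    ((- lam * P (b - lam * t) t - F (b - lam * t) t) +
     (lam * e * P (e * (b - lam * t)) t + F (e * (b - lam * t)) t)).
Proof.
  intros HP HF Hcons He HL.
  set (g := fun z x => (b - lam * z) * P (x * (b - lam * z)) z).
  set (dg := fun z x => - lam * P (x * (b - lam * z)) z + (b - lam * z) *
     (Ps (x * (b - lam * z)) z * (- lam * x) + Pt (x * (b - lam * z)) z)).
  assert (Hmin : Rmin e 1 = e) by (apply Rmin_left; lra).
  assert (Hmax : Rmax e 1 = 1) by (apply Rmax_right; lra).
  assert (HLloc : locally t (fun z => 0 < b - lam * z)).
  { destruct (cone_region_open b lam 1 t Rlt_0_1 HL) as [d Hd].
    exists d. intros z Hz. apply (Hd z 1 Hz).
    replace (1 - 1) with 0 by ring. rewrite Rabs_R0. apply cond_pos. }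
  assert (Hdg : forall z x, 0 < x -> 0 < b - lam * z ->
                is_derive (fun z => g z x) z (dg z x)).
  { intros z x Hx Hz. now apply is_derive_cone_density. }
  assert (CL : forall z x, continuity_2d_pt (fun u _ => b - lam * u) z x).
  { intros z x. apply continuity_2d_pt_minus; [apply continuity_2d_pt_const|].
    apply continuity_2d_pt_mult; [apply continuity_2d_pt_const|].
    apply continuity_2d_pt_id1. }
  assert (Hcont : forall z x, 0 < x -> 0 < b - lam * z ->
            continuity_2d_pt g z x /\ continuity_2d_pt dg z x).
  { intros z x Hx Hz.
    assert (Hs : 0 < x * (b - lam * z)) by now apply Rmult_lt_0_compat.
    assert (CP := C1_pos_continuity_2d_pt _ _ _ _ z HP Hs).
    destruct (HP _ z Hs) as (_ & CPs & CPt).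
    split.
    - apply continuity_2d_pt_mult; [apply CL|].
      now apply continuity_2d_pt_cone.
    - apply continuity_2d_pt_plus.
      + apply continuity_2d_pt_mult; [apply continuity_2d_pt_const|].
        now apply continuity_2d_pt_cone.
      + apply continuity_2d_pt_mult; [apply CL|].
        apply continuity_2d_pt_plus; [apply continuity_2d_pt_mult|];
          try now apply continuity_2d_pt_cone.
        apply continuity_2d_pt_mult; [apply continuity_2d_pt_const|].
        apply continuity_2d_pt_id2. }
  assert (Hint : RInt (dg t) e 1 =
     (- lam * P (b - lam * t) t - F (b - lam * t) t) +
     (lam * e * P (e * (b - lam * t)) t + F (e * (b - lam * t)) t)).
  { apply is_RInt_unique.
    (* A primitive in x of [dg t], once P_t is replaced by - F_s. *)
    set (A := fun x => - lam * x * P (x * (b - lam * t)) t - F (x * (b - lam * t)) t).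
    replace (- lam * P (b - lam * t) t - F (b - lam * t) t +
      (lam * e * P (e * (b - lam * t)) t + F (e * (b - lam * t)) t))
      with (minus (A 1) (A e)).
    2:{ unfold A, minus, plus, opp; simpl. rewrite Rmult_1_l. ring. }
    apply (is_RInt_derive (V := R_CompleteNormedModule) A (dg t)).
    - rewrite Hmin, Hmax. intros x Hx.
      assert (Hs : 0 < x * (b - lam * t)) by (apply Rmult_lt_0_compat; lra).
      assert (D1 : is_derive (fun x => x * (b - lam * t)) x (b - lam * t)).
      { auto_derive; [trivial | ring]. }
      assert (D0 : is_derive (fun _ : R => t) x 0).
      { apply (is_derive_const (V := R_NormedModule)). }
      assert (DP := is_derive_comp_2d P _ _ x _ _ _ _ (proj1 (HP _ t Hs)) D1 D0).
      assert (DF := is_derive_comp_2d F _ _ x _ _ _ _ (proj1 (HF _ t Hs)) D1 D0).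
      evar_last.
      + apply (is_derive_minus (K := R_AbsRing) (V := R_NormedModule)
          (fun x => - lam * x * P (x * (b - lam * t)) t)
          (fun x => F (x * (b - lam * t)) t)); [|exact DF].
        apply (is_derive_mult (fun x => - lam * x)); [| exact DP |].
        * auto_derive; [trivial | reflexivity].
        * intros; apply Rmult_comm.
      + unfold dg. rewrite (Hcons _ t Hs).
        unfold minus, plus, opp, mult; simpl. ring.
    - rewrite Hmin, Hmax. intros x Hx.
      apply continuous_2d_snd, Hcont; lra. }
  rewrite <- Hint.
  rewrite (RInt_ext (dg t) (fun x => Derive (fun u => g u x) t)).
  2:{ rewrite Hmin, Hmax. intros x Hx. symmetry.
      apply is_derive_unique, Hdg; lra. }
  apply (is_derive_RInt_param g e 1 t).
  - rewrite Hmin, Hmax. revert HLloc. apply filter_imp. intros z Hz x Hx.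
    exists (dg z x). apply Hdg; lra.
  - rewrite Hmin, Hmax. intros x Hx.
    (* [Derive] is known to agree with [dg] only for x > 0 and L > 0, so the open region of
       [cone_region_open] is used. *)
    apply continuity_2d_pt_ext_loc with dg; [|apply Hcont; lra].
    destruct (cone_region_open b lam x t ltac:(lra) HL) as [d Hd].
    exists d. intros u v Hu Hv. destruct (Hd u v Hu Hv).
    symmetry. apply is_derive_unique. now apply Hdg.
  - revert HLloc. apply filter_imp. intros z Hz.
    apply (ex_RInt_continuous (V := R_CompleteNormedModule)).
    rewrite Hmin, Hmax. intros x Hx. apply continuous_2d_snd, Hcont; lra.
Qed.

(** Continuity up to s = 0 is expressed by even reflection, f(|s|, t), so that ordinary two-sided
    continuity applies and values at s < 0 are never consulted. *)
Definition C1_half (f fs ft : R -> R -> R) : Prop :=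
  C1_pos f fs ft /\ forall s t, continuity_2d_pt (fun u v => f (Rabs u) v) s t.

(** The equations are required for s > 0 only; the shoreline enters through the continuity in
    [C1_half]. *)
Definition cg_solution (m : R) (psi phi : R -> R -> R) : Prop :=
  exists psis psit phis phit : R -> R -> R,
    C1_half psi psis psit /\ C1_half phi phis phit /\
    forall s t, 0 < s ->
      psit s t + m / (m + 1) * s * phis s t + phi s t = 0 /\
      phit s t + psis s t = 0.

(* s^(1/m); the exponent is the one for which (m / (m + 1) s weight)' = weight. *)
Definition weight (m s : R) : R := exp (ln s / m).

Lemma C1_pos_weight (m : R) :
  0 < m ->
  C1_pos (fun s _ => weight m s) (fun s _ => weight m s / (m * s)) (fun _ _ => 0).
Proof.
  intros Hm. apply (C1_pos_fst (weight m) (fun s => weight m s / (m * s))).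
  intros s Hs. unfold weight. split.
  - auto_derive; [exact Hs|]. unfold Rdiv. field; split; lra.
  - apply continuity_pt_filterlim.
    apply (ex_derive_continuous (V := R_NormedModule)
             (fun s => exp (ln s / m) / (m * s))).
    auto_derive. split; [exact Hs|]. split; [nra|trivial].
Qed.

Lemma weight_le (m s s' : R) : 0 < m -> 0 < s -> s <= s' -> weight m s <= weight m s'.
Proof.
  intros Hm Hs Hss'. unfold weight.
  destruct Hss' as [Hlt|<-]; [|apply Rle_refl].
  apply Rlt_le, exp_increasing, Rmult_lt_compat_r; [now apply Rinv_0_lt_compat|].
  now apply ln_increasing.
Qed.

Definition energy (m : R) (psi phi : R -> R -> R) (s t : R) : R :=
  weight m s * (psi s t * psi s t + (m / (m + 1) * s) * (phi s t * phi s t)).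

Definition flux (m : R) (psi phi : R -> R -> R) (s t : R) : R :=
  weight m s * ((2 * m / (m + 1) * s) * (psi s t * phi s t)).

(** With w the weight and c = m / (m + 1), add 2 w psi times the first equation to 2 c s w phi times
    the second. The terms without derivatives combine into an s-derivative because (c s w)' = w. *)
Lemma energy_conservation (m : R) (psi phi : R -> R -> R) :
  0 < m -> cg_solution m psi phi ->
  exists Ps Pt Fs Ft : R -> R -> R,
    C1_pos (energy m psi phi) Ps Pt /\ C1_pos (flux m psi phi) Fs Ft /\
    forall s t, 0 < s -> Pt s t = - Fs s t.
Proof.
  intros Hm (psis & psit & phis & phit & [H1 _] & [H2 _] & Heq).
  assert (Hlin : forall k, C1_pos (fun s _ => k * s) (fun _ _ => k) (fun _ _ => 0)).
  { intros k. apply (C1_pos_fst (fun s => k * s) (fun _ => k)). intros s _. split.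
    - auto_derive; [trivial | ring].
    - apply continuity_pt_const; intros ? ?; reflexivity. }
  (* The four derivatives are read off from the product rule by unification. *)
  do 4 eexists. split; [|split].
  - apply C1_pos_mult; [now apply C1_pos_weight|].
    apply C1_pos_plus; [apply C1_pos_mult; exact H1|].
    apply C1_pos_mult; [apply Hlin|]. apply C1_pos_mult; exact H2.
  - apply C1_pos_mult; [now apply C1_pos_weight|].
    apply C1_pos_mult; [apply Hlin|]. apply C1_pos_mult; [exact H1 | exact H2].
  - intros s t Hs; simpl. destruct (Heq s t Hs) as [E1 E2].
    replace (psit s t) with (- (m / (m + 1) * s * phis s t + phi s t)) by lra.
    replace (phit s t) with (- psis s t) by lra.
    field; lra.
Qed.

(** The first two bounds make the inner side of the cone O(e). The third controls the outer side:
    the characteristic speed sqrt(c s) does not exceed lam, so no energy enters there. *)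
Lemma energy_flux_bounds (m : R) (psi phi : R -> R -> R) (s t b M : R) :
  0 < m -> 0 < s <= b -> Rabs (psi s t) <= M -> Rabs (phi s t) <= M ->
  0 <= energy m psi phi s t <= weight m b * ((1 + b) * (M * M)) /\
  flux m psi phi s t <= s * (2 * weight m b * (M * M)) /\
  forall lam, 0 < lam -> s <= lam * lam ->
    - lam * energy m psi phi s t - flux m psi phi s t <= 0.
Proof.
  intros Hm Hs H1 H2. unfold energy, flux.
  assert (Hw : 0 < weight m s) by apply exp_pos.
  assert (Hwb := weight_le m s b Hm (proj1 Hs) (proj2 Hs)).
  set (w := weight m s) in *. set (W := weight m b) in *.
  set (p := psi s t) in *. set (q := phi s t) in *.
  replace (2 * m / (m + 1)) with (2 * (m / (m + 1))) by (field; lra).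
  assert (Hc : 0 < m / (m + 1) < 1).
  { split; [apply Rdiv_lt_0_compat; lra|].
    apply Rmult_lt_reg_r with (m + 1); [lra|]. field_simplify; lra. }
  set (c := m / (m + 1)) in *.
  assert (HM : 0 <= M) by (generalize (Rabs_pos p); lra).
  apply Rabs_le_between in H1; apply Rabs_le_between in H2.
  assert (Hpp : 0 <= p * p <= M * M) by nra.
  assert (Hqq : 0 <= q * q <= M * M) by nra.
  assert (Hpq : p * q <= M * M) by nra.
  assert (Hcs : 0 < c * s <= s) by nra.
  split; [split|split].
  - apply Rmult_le_pos; nra.
  - apply Rmult_le_compat; nra.
  - replace (s * (2 * W * (M * M))) with (W * (2 * s * (M * M))) by ring.
    apply Rle_trans with (w * (2 * s * (M * M))).
    + apply Rmult_le_compat_l; [lra|].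
      replace (2 * c * s * (p * q)) with (2 * (c * s) * (p * q)) by ring.
      apply Rle_trans with (2 * (c * s) * (M * M)); [|nra].
      apply Rmult_le_compat_l; lra.
    + apply Rmult_le_compat_r; [|lra]. apply Rmult_le_pos; [lra|nra].
  - intros lam Hl Hsl.
    (* Completing the square after multiplication by lam; the remaining term is nonnegative since c
       s <= s <= lam^2. *)
    assert (Hk : 0 <= lam * (p * p + c * s * (q * q)) + 2 * (c * s) * (p * q)).
    { apply Rmult_le_reg_l with lam; [exact Hl|]. rewrite Rmult_0_r.
      replace (lam * (lam * (p * p + c * s * (q * q)) + 2 * (c * s) * (p * q)))
        with ((lam * p + c * s * q) * (lam * p + c * s * q)
              + c * s * (lam * lam - c * s) * (q * q)) by ring.
      apply Rplus_le_le_0_compat; [apply Rle_0_sqr|].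
      apply Rmult_le_pos; [|lra]. apply Rmult_le_pos; lra. }
    nra.
Qed.

Lemma C1_half_bounded (f fs ft : R -> R -> R) (b T : R) :
  C1_half f fs ft ->
  exists M, 0 <= M /\ forall s t, 0 <= s <= b -> 0 <= t <= T -> Rabs (f s t) <= M.
Proof.
  intros [_ H].
  destruct (continuity_2d_pt_bounded (fun u v => f (Rabs u) v) 0 b 0 T) as (M & HM & HB).
  { intros; apply H. }
  exists M. split; [exact HM|]. intros s t Hs Ht.
  specialize (HB s t Hs Ht). now rewrite (Rabs_pos_eq s) in HB by lra.
Qed.

Lemma ex_RInt_cone (f fs ft : R -> R -> R) (L k t a b : R) :
  C1_pos f fs ft -> 0 < L -> 0 < a <= b ->
  ex_RInt (fun x => k * f (x * L) t) a b.
Proof.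
  intros Hf HL Hab.
  apply (ex_RInt_continuous (V := R_CompleteNormedModule)).
  rewrite Rmin_left, Rmax_right by lra. intros x Hx.
  apply (ex_derive_continuous (V := R_NormedModule)).
  assert (Hs : 0 < x * L) by (apply Rmult_lt_0_compat; lra).
  assert (D1 : is_derive (fun x => x * L) x L) by (auto_derive; [trivial | ring]).
  assert (D0 : is_derive (fun _ : R => t) x 0).
  { apply (is_derive_const (V := R_NormedModule)). }
  assert (D := is_derive_comp_2d f _ _ x _ _ _ _ (proj1 (Hf _ t Hs)) D1 D0).
  eexists. apply (is_derive_scal _ x k _ D).
Qed.

(** The constants [L] and [K] are chosen before [e], so that [e] can later tend to 0. *)
Lemma cone_energy_estimate (m T : R) (psi phi : R -> R -> R) :
  0 < m -> 0 <= T -> cg_solution m psi phi ->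
  (forall s, 0 < s -> psi s 0 = 0 /\ phi s 0 = 0) ->
  exists L K, 0 < L /\ 0 <= K /\ forall e, 0 < e <= 1 ->
    RInt (fun x => L * energy m psi phi (x * L) T) e 1 <= K * e.
Proof.
  intros Hm HT Hsol H0.
  destruct (energy_conservation m psi phi Hm Hsol) as (Ps & Pt & Fs & Ft & HP & HF & HC).
  destruct Hsol as (psis & psit & phis & phit & C1 & C2 & _).
  (* Then b - lam t = lam (lam - t) is positive for t <= T, so the cone has not closed at time T,
     and every s <= b satisfies s <= lam^2. *)
  set (lam := T + 1). set (b := lam * lam).
  destruct (C1_half_bounded _ _ _ b T C1) as (M1 & HM1 & HB1).
  destruct (C1_half_bounded _ _ _ b T C2) as (M2 & HM2 & HB2).
  set (M := Rmax M1 M2).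
  assert (HM : 0 <= M) by (eapply Rle_trans; [exact HM1 | apply Rmax_l]).
  assert (Hlam : 0 < lam) by (unfold lam; lra).
  assert (Hb : 0 < b) by (unfold b; nra).
  set (W := weight m b). assert (HW : 0 < W) by apply exp_pos.
  (* Bound for the contribution of the inner side, divided by e: the energy term carries the factor
     lam e, and the flux at s = e L is at most e b (2 W M^2). *)
  set (K0 := lam * (W * ((1 + b) * (M * M))) + b * (2 * W * (M * M))).
  assert (HMM : 0 <= M * M) by nra.
  assert (HK0 : 0 <= K0).
  { unfold K0. repeat (apply Rplus_le_le_0_compat || apply Rmult_le_pos); lra. }
  assert (HL : forall t, 0 <= t <= T -> 0 < b - lam * t <= b).
  { intros t Ht. unfold b, lam. nra. }
  exists (b - lam * T), (K0 * T).
  split; [apply HL; lra|]. split; [now apply Rmult_le_pos|]. intros e He.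
  set (E := fun t => RInt (fun x => (b - lam * t) * energy m psi phi (x * (b - lam * t)) t) e 1).
  set (P := energy m psi phi) in *. set (F := flux m psi phi) in *.
  set (dE := fun t => (- lam * P (b - lam * t) t - F (b - lam * t) t) +
     (lam * e * P (e * (b - lam * t)) t + F (e * (b - lam * t)) t)).
  assert (HdE : forall t, 0 <= t <= T -> is_derive E t (dE t)).
  { intros t Ht. apply (conservation_law_cone P Ps Pt F Fs Ft); auto. apply HL, Ht. }
  assert (HE0 : E 0 = 0).
  { unfold E. rewrite (RInt_ext _ (fun _ => 0)).
    - rewrite RInt_const. unfold scal; simpl; unfold mult; simpl. ring.
    - rewrite Rmin_left, Rmax_right by lra. intros x Hx.
      assert (Hs : 0 < x * (b - lam * 0)).
      { apply Rmult_lt_0_compat; [lra | apply HL; lra]. }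
      destruct (H0 _ Hs) as [Ha Hb']. unfold P, energy. rewrite Ha, Hb'.
      rewrite !Rmult_0_r, Rplus_0_r, !Rmult_0_r. reflexivity. }
  assert (HdEle : forall t, 0 <= t <= T -> dE t <= K0 * e).
  { intros t Ht. destruct (HL t Ht) as [HL1 HL2].
    assert (Bd : forall s, 0 < s <= b -> Rabs (psi s t) <= M /\ Rabs (phi s t) <= M).
    { intros s Hs. split.
      - eapply Rle_trans; [apply HB1; lra | apply Rmax_l].
      - eapply Rle_trans; [apply HB2; lra | apply Rmax_r]. }
    assert (He' : 0 < e * (b - lam * t) <= b) by nra.
    destruct (Bd _ (conj HL1 HL2)) as [B1 B2]. destruct (Bd _ He') as [B3 B4].
    destruct (energy_flux_bounds m psi phi _ t b M Hm (conj HL1 HL2) B1 B2) as (_ & _ & Hout).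
    destruct (energy_flux_bounds m psi phi _ t b M Hm He' B3 B4) as ([Hp0 Hp] & Hf & _).
    specialize (Hout lam Hlam HL2).
    fold P in Hout, Hp0, Hp. fold F in Hout, Hf. fold W in Hp, Hf.
    unfold dE, K0.
    assert (I1 : lam * e * P (e * (b - lam * t)) t <= lam * e * (W * ((1 + b) * (M * M)))).
    { apply Rmult_le_compat_l; [apply Rmult_le_pos; lra | exact Hp]. }
    assert (I2 : e * (b - lam * t) * (2 * W * (M * M)) <= e * b * (2 * W * (M * M))).
    { apply Rmult_le_compat_r; [repeat apply Rmult_le_pos; lra|].
      apply Rmult_le_compat_l; lra. }
    lra. }
  destruct (MVT_gen E 0 T dE) as (t & Ht & HMVT).
  - rewrite Rmin_left, Rmax_right by lra. intros t Ht. apply HdE; lra.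
  - rewrite Rmin_left, Rmax_right by lra. intros t Ht.
    apply continuity_pt_filterlim.
    apply (ex_derive_continuous (V := R_NormedModule)). exists (dE t). now apply HdE.
  - rewrite Rmin_left, Rmax_right in Ht by lra.
    change (E T <= K0 * T * e). rewrite HE0 in HMVT. specialize (HdEle t Ht). nra.
Qed.

(** If psi(0, T) were nonzero, continuity would keep psi^2 away from 0 near the shoreline. The
    energy on a fixed interval there would then have a positive lower bound independent of e,
    against the upper bound K e. *)
Lemma cg_solution_zero_data (m : R) (psi phi : R -> R -> R) :
  0 < m -> cg_solution m psi phi ->
  (forall s, 0 < s -> psi s 0 = 0 /\ phi s 0 = 0) ->
  forall T, 0 <= T -> psi 0 T = 0.
Proof.
  intros Hm Hsol H0 T HT.
  destruct (cone_energy_estimate m T psi phi Hm HT Hsol H0) as (L & K & HL & HK & Hest).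
  destruct (energy_conservation m psi phi Hm Hsol) as (Ps & Pt & Fs & Ft & HP & _).
  destruct Hsol as (psis & psit & phis & phit & [_ C1] & _).
  destruct (Req_dec (psi 0 T) 0) as [Hz|Hz]; [exact Hz | exfalso].
  assert (Hp : 0 < Rabs (psi 0 T) / 2) by (generalize (Rabs_pos_lt _ Hz); lra).
  set (p := Rabs (psi 0 T) / 2) in *.
  destruct (C1 0 T (mkposreal p Hp)) as [d Hd]. simpl in Hd.
  assert (Hlow : forall s, 0 < s < d -> p * p <= psi s T * psi s T).
  { intros s Hs. specialize (Hd s T).
    rewrite Rminus_0_r, (Rabs_pos_eq s), Rabs_R0 in Hd by lra.
    replace (T - T) with 0 in Hd by ring. rewrite Rabs_R0 in Hd.
    specialize (Hd (proj2 Hs) (cond_pos d)).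
    assert (Hq : p < Rabs (psi s T)).
    { assert (H1 := Rabs_triang_inv (psi 0 T) (psi 0 T - psi s T)).
      replace (psi 0 T - (psi 0 T - psi s T)) with (psi s T) in H1 by ring.
      rewrite (Rabs_minus_sym (psi 0 T)) in H1. unfold p in *. lra. }
    rewrite <- (Rabs_pos_eq (psi s T * psi s T)) by nra. rewrite Rabs_mult. nra. }
  assert (Hs1 : exists s1, 0 < s1 <= 1 /\ s1 * L < d).
  { exists (Rmin 1 (d / (2 * L))). assert (Hd0 := cond_pos d).
    assert (0 < d / (2 * L)) by (apply Rdiv_lt_0_compat; lra).
    split; [split; [apply Rmin_pos; lra | apply Rmin_l]|].
    apply Rle_lt_trans with (d / (2 * L) * L).
    - apply Rmult_le_compat_r; [lra | apply Rmin_r].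
    - replace (d / (2 * L) * L) with (d / 2) by (field; lra). lra. }
  destruct Hs1 as (s1 & Hs1 & Hs1d).
  (* Staying in [s0, s1] bounds the weight from below by its value at s0 L > 0. The length s1 - s0
     equals s0, whence the lower bound k s0. *)
  set (s0 := s1 / 2).
  set (k := L * (weight m (s0 * L) * (p * p))).
  assert (Hk : 0 < k).
  { apply Rmult_lt_0_compat; [exact HL|].
    apply Rmult_lt_0_compat; [apply exp_pos|].
    now apply Rmult_lt_0_compat. }
  set (f := fun x => L * energy m psi phi (x * L) T).
  assert (Hc : 0 < m / (m + 1)) by (apply Rdiv_lt_0_compat; lra).
  assert (Hfpos : forall x, 0 < x -> 0 <= f x).
  { intros x Hx. unfold f, energy.
    assert (0 < x * L) by now apply Rmult_lt_0_compat.
    apply Rmult_le_pos; [lra|]. apply Rmult_le_pos; [apply Rlt_le, exp_pos|].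
    apply Rplus_le_le_0_compat; [nra|]. apply Rmult_le_pos; [|nra].
    apply Rmult_le_pos; lra. }
  assert (Hflow : forall x, s0 < x < s1 -> k <= f x).
  { intros x Hx. unfold f, k, energy. apply Rmult_le_compat_l; [lra|].
    assert (Hs0 : 0 < s0) by (unfold s0; lra).
    assert (0 < s0 * L) by now apply Rmult_lt_0_compat.
    assert (Hxl : s0 * L <= x * L) by (apply Rmult_le_compat_r; lra).
    apply Rmult_le_compat; [apply Rlt_le, exp_pos | nra | apply weight_le; lra|].
    assert (Hxd : 0 < x * L < d) by nra.
    assert (0 <= m / (m + 1) * (x * L) * (phi (x * L) T * phi (x * L) T)).
    { apply Rmult_le_pos; [apply Rmult_le_pos; lra | nra]. }
    specialize (Hlow _ Hxd). lra. }
  assert (Hex : forall a b, 0 < a <= b -> ex_RInt f a b).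
  { intros a b Hab. now apply (ex_RInt_cone _ _ _ L L T a b HP). }
  assert (Hbelow : forall e, 0 < e <= s0 -> k * s0 <= RInt f e 1).
  { intros e He. unfold s0 in *.
    rewrite <- (RInt_Chasles f e s0 1), <- (RInt_Chasles f s0 s1 1)
      by (apply Hex; unfold s0; lra).
    unfold plus; simpl.
    assert (0 <= RInt f e s0).
    { apply RInt_ge_0; [unfold s0; lra | apply Hex; unfold s0; lra |].
      intros x Hx; apply Hfpos; lra. }
    assert (0 <= RInt f s1 1).
    { apply RInt_ge_0; [lra | apply Hex; lra |]. intros x Hx; apply Hfpos; lra. }
    assert (k * (s1 / 2) <= RInt f s0 s1).
    { replace (k * (s1 / 2)) with (RInt (fun _ => k) s0 s1).
      - apply RInt_le; [unfold s0; lra | apply ex_RInt_const | |exact Hflow].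
        apply Hex; unfold s0; lra.
      - rewrite RInt_const. unfold scal; simpl; unfold mult; simpl. unfold s0. field. }
    unfold s0 in *. lra. }
  assert (Hs0 : 0 < s0 <= 1) by (unfold s0; lra).
  assert (Hks : 0 < k * s0) by (apply Rmult_lt_0_compat; lra).
  (* Small enough for K e <= k s0 / 2; K + 1 in the denominator covers K = 0. *)
  set (e := Rmin s0 (k * s0 / (2 * (K + 1)))).
  assert (He : 0 < e <= s0).
  { unfold e. split; [|apply Rmin_l]. apply Rmin_pos; [lra|].
    apply Rdiv_lt_0_compat; lra. }
  assert (HKe : K * e <= k * s0 / 2).
  { apply Rle_trans with ((K + 1) * (k * s0 / (2 * (K + 1)))).
    - apply Rmult_le_compat; try lra. apply Rmin_r.
    - right; field; lra. }
  specialize (Hbelow e He). specialize (Hest e ltac:(lra)). fold f in Hest. lra.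
Qed.

(** * From the shallow water equations to the linear system *)

Lemma has_partials_on_of_extension (D : R -> R -> Prop) (f g : R -> R -> R)
    (x y fx fy : R) :
  D x y -> (forall u v, D u v -> g u v = f u v) ->
  differentiable_pt_lim g x y fx fy -> has_partials_on D f x y fx fy.
Proof.
  intros HD Hg H. apply filterdiff_differentiable_pt_lim in H.
  destruct H as [Hlin H]. split; [exact Hlin|].
  intros q Hq.
  (* [filterdiff] quantifies over all limits q of the restricted filter. Since (x, y) itself lies in
     [D], such a q is also a limit of the full neighbourhood filter, which forces q = (x, y). *)
  assert (Hq' : is_filter_lim (locally (x, y)) q).
  { intros P HP. apply locally_locally in HP.
    specialize (Hq _ HP). unfold within in Hq.
    apply locally_singleton in Hq. exact (Hq HD). }
  assert (E : (x, y) = q) by now apply (is_filter_lim_locally_unique (K := R_AbsRing)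
      (V := prod_NormedModule R_AbsRing R_NormedModule R_NormedModule)).
  intros eps. specialize (H q Hq' eps). unfold within.
  revert H. apply filter_imp. intros p Hp Hdp.
  subst q. simpl in *. rewrite (Hg _ _ HD), (Hg _ _ Hdp) in Hp. exact Hp.
Qed.

Lemma has_partials_on_interior (D : R -> R -> Prop) (f : R -> R -> R)
    (x y fx fy : R) :
  locally_2d D x y -> has_partials_on D f x y fx fy ->
  differentiable_pt_lim f x y fx fy.
Proof.
  intros HD H.
  destruct (has_partials_on_extension D f x y fx fy) as (g & Hg & Hdiff); auto.
  { destruct HD as [d Hd]. apply Hd; rewrite Rminus_diag, Rabs_R0; apply cond_pos. }
  apply differentiable_pt_lim_ext with g; [|exact Hdiff].
  destruct HD as [d Hd]. exists d. auto.
Qed.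

Lemma differentiable_pt_lim_inj (f : R -> R -> R) (x y a b a' b' : R) :
  differentiable_pt_lim f x y a b -> differentiable_pt_lim f x y a' b' ->
  a = a' /\ b = b'.
Proof.
  intros H H'. apply differentiable_pt_lim_unique in H, H'.
  destruct H as [<- <-]. exact H'.
Qed.

Lemma half_plane_interior (s t : R) : 0 < s -> locally_2d half_plane s t.
Proof.
  intros Hs. exists (mkposreal s Hs). simpl. intros u v Hu _.
  apply Rabs_def2 in Hu. unfold half_plane. lra.
Qed.

(** Continuity of the first derivatives follows from their own differentiability. At the shoreline
    an extension of f is continuous, and composing it with the 1-Lipschitz map |.| gives the
    reflected function. *)
Lemma smooth_on_half_plane_C1_half (f : R -> R -> R) :
  smooth_on half_plane f -> exists fs ft, C1_half f fs ft.
Proof.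
  intros (d & Hd0 & Hd). exists (d 1%nat 0%nat), (d 0%nat 1%nat).
  assert (Hc : forall i j s t, 0 < s -> continuity_2d_pt (d i j) s t).
  { intros i j s t Hs. apply differentiable_continuity_pt.
    exists (d (S i) j s t), (d i (S j) s t).
    apply (has_partials_on_interior half_plane); [now apply half_plane_interior|].
    apply Hd. unfold half_plane; lra. }
  split.
  - intros s t Hs. split; [|split; now apply Hc].
    apply differentiable_pt_lim_ext with (d 0%nat 0%nat).
    + destruct (half_plane_interior s t Hs) as [e He].
      exists e. auto.
    + apply (has_partials_on_interior half_plane); [now apply half_plane_interior|].
      apply Hd. unfold half_plane; lra.
  - intros s t.
    assert (Hs : half_plane (Rabs s) t) by apply Rabs_pos.
    destruct (has_partials_on_extension half_plane _ _ _ _ _ Hs (Hd 0%nat 0%nat _ _ Hs))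
      as (g & Hg & Hdiff).
    assert (Hgc : continuity_2d_pt g (Rabs s) t).
    { apply differentiable_continuity_pt. eexists; eexists; exact Hdiff. }
    apply continuity_2d_pt_ext with (fun u v => g (Rabs u) v).
    + intros u v. assert (Hu : half_plane (Rabs u) v) by apply Rabs_pos.
      rewrite (Hg _ _ Hu). now apply Hd0.
    + intros eps. destruct (Hgc eps) as [e He]. exists e. intros u v Hu Hv.
      apply He; [|exact Hv].
      eapply Rle_lt_trans; [apply Rabs_triang_inv2 | exact Hu].
Qed.

(** * The Carrier-Greenspan change of variables *)

Lemma differentiable_pt_lim_fst (x y : R) :
  differentiable_pt_lim (fun u _ => u) x y 1 0.
Proof. apply (differentiable_pt_lim_proj1_0 (fun u => u)), derivable_pt_lim_id. Qed.

Lemma differentiable_pt_lim_snd (x y : R) :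
  differentiable_pt_lim (fun _ v => v) x y 0 1.
Proof.
  intros eps. exists (mkposreal 1 Rlt_0_1). intros u v _ _.
  match goal with |- Rabs ?a <= _ => replace a with 0 by ring end.
  rewrite Rabs_R0. apply Rmult_le_pos; [apply Rlt_le, cond_pos|].
  eapply Rle_trans; [apply Rabs_pos | apply Rmax_l].
Qed.

Lemma differentiable_pt_lim_scal (k : R) (f : R -> R -> R) (x y fx fy : R) :
  differentiable_pt_lim f x y fx fy ->
  differentiable_pt_lim (fun u v => k * f u v) x y (k * fx) (k * fy).
Proof.
  intros H. eapply differentiable_pt_lim_eq.
  - apply (differentiable_pt_lim_mult (fun _ _ => k)); [|exact H].
    apply (differentiable_pt_lim_proj1_0 (fun _ => k)), derivable_pt_lim_const.
  - ring.
  - ring.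
Qed.

Lemma differentiable_pt_lim_cg_sigma (eta : R -> R -> R) (x t ex et : R) :
  differentiable_pt_lim eta x t ex et ->
  differentiable_pt_lim (cg_sigma eta) x t (1 + ex) et.
Proof.
  intros H. eapply differentiable_pt_lim_eq.
  - apply differentiable_pt_lim_plus; [apply differentiable_pt_lim_fst | exact H].
  - reflexivity.
  - ring.
Qed.

Lemma differentiable_pt_lim_cg_tau (u : R -> R -> R) (x t ux ut : R) :
  differentiable_pt_lim u x t ux ut ->
  differentiable_pt_lim (cg_tau u) x t (- ux) (1 - ut).
Proof.
  intros H. eapply differentiable_pt_lim_eq.
  - apply differentiable_pt_lim_ext with (fun x t => t + -1 * u x t).
    + exists (mkposreal 1 Rlt_0_1). intros; unfold cg_tau; ring.
    + apply differentiable_pt_lim_plus; [apply differentiable_pt_lim_snd|].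
      apply differentiable_pt_lim_scal, H.
  - ring.
  - ring.
Qed.

(** The derivatives of sigma and tau relative to the wet region are computed on extensions of [eta]
    and [u], so the ordinary rules apply on the shoreline too. *)
Lemma cgt_jacobian (eta u : R -> R -> R) (x t ex et ux ut : R) :
  cgt_invertible eta u -> wet eta x t ->
  has_partials_on (wet eta) eta x t ex et ->
  has_partials_on (wet eta) u x t ux ut ->
  (1 + ex) * (1 - ut) - et * - ux <> 0.
Proof.
  intros (_ & _ & HJ) Hw He Hu. apply (HJ x t Hw).
  - destruct (has_partials_on_extension _ _ _ _ _ _ Hw He) as (g & Hg & Hd).
    apply has_partials_on_of_extension with (cg_sigma g); [exact Hw | |].
    + intros a b Hab. unfold cg_sigma. now rewrite Hg.
    + now apply differentiable_pt_lim_cg_sigma.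
  - destruct (has_partials_on_extension _ _ _ _ _ _ Hw Hu) as (g & Hg & Hd).
    apply has_partials_on_of_extension with (cg_tau g); [exact Hw | |].
    + intros a b Hab. unfold cg_tau. now rewrite Hg.
    + now apply differentiable_pt_lim_cg_tau.
Qed.

(* [k] is m / (m + 1) sigma. *)
Lemma hodograph_algebra (k u ex et ux ut ps pt fs ft : R) :
  et + u * (1 + ex) + k * ux = 0 -> ut + u * ux + ex = 0 ->
  ux = fs * (1 + ex) + ft * - ux -> ut = fs * et + ft * (1 - ut) ->
  ex + u * ux = ps * (1 + ex) + pt * - ux ->
  et + u * ut = ps * et + pt * (1 - ut) ->
  (1 + ex) * (1 - ut) - et * - ux <> 0 ->
  pt + k * fs + u = 0 /\ ft + ps = 0.
Proof.
  intros E1 E2 F1 F2 P1 P2 HJ.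
  set (J := (1 + ex) * (1 - ut) - et * - ux) in *.
  (* Cramer's rule for the chain-rule equations. Multiplying the goals by J leaves polynomial
     identities, closed by eliminating [ut] and [et] through the shallow water equations. *)
  assert (cramer : forall a b p q, a = p * (1 + ex) + q * - ux -> b = p * et + q * (1 - ut) ->
    J * p = a * (1 - ut) + b * ux /\ J * q = (1 + ex) * b - et * a).
  { intros a b p q -> ->. unfold J. split; ring. }
  destruct (cramer _ _ _ _ F1 F2) as [A1 A2], (cramer _ _ _ _ P1 P2) as [A3 A4].
  split; apply Rmult_eq_reg_l with J; try exact HJ; rewrite Rmult_0_r.
  - replace (J * (pt + k * fs + u)) with (J * pt + k * (J * fs) + J * u) by ring.
    rewrite A1, A4. unfold J.
    replace ut with (- u * ux - ex) by lra.
    replace et with (- u * (1 + ex) - k * ux) by lra. ring.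
  - rewrite Rmult_plus_distr_l, A2, A3.
    replace ut with (- u * ux - ex) by lra.
    replace et with (- u * (1 + ex) - k * ux) by lra. ring.
Qed.

(** A point with s > 0 comes from an interior wet point. Differentiating phi(sigma, tau) = u and
    psi(sigma, tau) = eta + u^2 / 2 there gives the equations solved in [hodograph_algebra]. *)
Lemma nonbreaking_wave_cg_solution (m : R) (eta u : R -> R -> R) (r : R -> R)
    (psi phi : R -> R -> R) :
  nonbreaking_wave m eta u r psi phi -> cg_solution m psi phi.
Proof.
  intros (Hswe & Hfree & _ & _ & Hinv & Him & Hpsi & Hphi).
  destruct (smooth_on_half_plane_C1_half psi Hpsi) as (ps & pt & Hp).
  destruct (smooth_on_half_plane_C1_half phi Hphi) as (fs & ft & Hf).
  exists ps, pt, fs, ft. split; [exact Hp|]. split; [exact Hf|].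
  intros s z Hs.
  destruct Hinv as (Hi1 & Hsurj & Hi3).
  destruct (Hsurj s z (Rlt_le _ _ Hs)) as (x & t & Hw & Hsig & Htau).
  destruct (Hswe x t Hw) as (ex & et & ux & ut & De & Du & E1 & E2).
  assert (HJ := cgt_jacobian eta u x t ex et ux ut (conj Hi1 (conj Hsurj Hi3)) Hw De Du).
  assert (Hsig' : x + eta x t = s) by exact Hsig.
  assert (Hloc : locally_2d (wet eta) x t).
  { apply locally_2d_locally, Hfree. lra. }
  apply (has_partials_on_interior _ _ _ _ _ _ Hloc) in De.
  apply (has_partials_on_interior _ _ _ _ _ _ Hloc) in Du.
  assert (Dsig := differentiable_pt_lim_cg_sigma _ _ _ _ _ De).
  assert (Dtau := differentiable_pt_lim_cg_tau _ _ _ _ _ Du).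
  assert (Dphi := proj1 (proj1 Hf s z Hs)).
  assert (Dpsi := proj1 (proj1 Hp s z Hs)).
  assert (Hu : phi s z = u x t).
  { rewrite <- Hsig, <- Htau. now apply Him. }
  rewrite Hu.
  rewrite <- Hsig, <- Htau in Dphi at 1. rewrite <- Hsig, <- Htau in Dpsi at 1.
  assert (Cphi := differentiable_pt_lim_comp _ _ _ _ _ _ _ _ _ _ _ Dphi Dsig Dtau).
  assert (Cpsi := differentiable_pt_lim_comp _ _ _ _ _ _ _ _ _ _ _ Dpsi Dsig Dtau).
  apply differentiable_pt_lim_ext with (f2 := u) in Cphi.
  2:{ destruct Hloc as [d Hd]. exists d. intros a b Ha Hb. now apply Him, Hd. }
  apply differentiable_pt_lim_ext
    with (f2 := fun x t => eta x t + / 2 * (u x t * u x t)) in Cpsi.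
  2:{ destruct Hloc as [d Hd]. exists d. intros a b Ha Hb.
      rewrite (proj2 (Him a b (Hd a b Ha Hb))). field. }
  (* Uniqueness of the differential equates the direct partial derivatives with those from the chain
     rule. *)
  destruct (differentiable_pt_lim_inj _ _ _ _ _ _ _ Du Cphi) as [F1 F2].
  destruct (differentiable_pt_lim_inj _ _ _ _ _ _ _
    (differentiable_pt_lim_plus _ _ _ _ _ _ _ _ De
      (differentiable_pt_lim_scal (/ 2) _ _ _ _ _
        (differentiable_pt_lim_mult _ _ _ _ _ _ _ _ Du Du))) Cpsi) as [P1 P2].
  rewrite Hsig' in E1.
  apply (hodograph_algebra _ (u x t) ex et ux ut); auto; lra.
Qed.

(** * Velocity of the shoreline *)

Lemma entire_ex_derive (r : R -> R) (t : R) : entire r -> ex_derive r t.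
Proof.
  intros (a & Ha & Hr).
  apply ex_derive_ext with (PSeries a); [now intros; symmetry|].
  apply ex_derive_PSeries. now rewrite Ha.
Qed.

Lemma shoreline_velocity (m : R) (eta u : R -> R -> R) (r : R -> R)
    (psi phi : R -> R -> R) (x t : R) :
  nonbreaking_wave m eta u r psi phi -> x + eta x t = 0 -> u x t = - Derive r t.
Proof.
  intros (Hswe & _ & Hrun & Hent & Hinv & _) Hx.
  assert (Hw : wet eta x t) by (unfold wet; lra).
  destruct (Hswe x t Hw) as (ex & et & ux & ut & De & Du & E1 & E2).
  assert (HJ := cgt_jacobian eta u x t ex et ux ut Hinv Hw De Du).
  (* At time z the shoreline is the single point x = - r z. *)
  assert (Hshore : forall z, - r z + eta (- r z) z = 0 /\ eta (- r z) z = r z).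
  { intros z. destruct (Hrun z) as [[y Hy] Hr].
    assert (Hry := Hr y Hy). replace (- r z) with y by lra. tauto. }
  destruct (has_partials_on_extension _ _ _ _ _ _ Hw De) as (g & Hg & Hd).
  assert (Hxr : x = - r t).
  { destruct (Hrun t) as [_ Hr]. specialize (Hr x Hx). lra. }
  assert (Dr := Derive_correct r t (entire_ex_derive r t Hent)).
  assert (Dmr : is_derive (fun z => - r z) t (- Derive r t)).
  { apply (is_derive_opp (K := R_AbsRing) (V := R_NormedModule) r t _ Dr). }
  rewrite Hxr in Hd.
  assert (Dg := is_derive_comp_2d g (fun z => - r z) (fun z => z) t ex et _ 1
                  Hd Dmr (is_derive_id t)).
  apply (is_derive_ext _ r) in Dg.
  2:{ intros z. destruct (Hshore z) as [H1 H2].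
      rewrite Hg; [exact H2 | unfold wet; lra]. }
  apply is_derive_unique in Dg.
  rewrite Hx, Rmult_0_r, Rmult_0_l, Rplus_0_r in E1.
  assert (H1 : (1 + ex) * (u x t + Derive r t) = 0) by lra.
  apply Rmult_integral in H1. destruct H1 as [H1|H1]; [|lra].
  (* If 1 + ex = 0, the first equation at sigma = 0 reduces to et = 0, and both products in the
     Jacobian vanish. *)
  exfalso. apply HJ. rewrite H1 in *. replace et with 0 by lra. ring.
Qed.

(** * Superposition, time reversal and parity in tau *)

Lemma C1_half_lincomb (k : R) (f fs ft g gs gt : R -> R -> R) :
  C1_half f fs ft -> C1_half g gs gt ->
  C1_half (fun s t => f s t + k * g s t) (fun s t => fs s t + k * gs s t)
          (fun s t => ft s t + k * gt s t).
Proof.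
  assert (Hc : forall a b : R -> R -> R, forall s t,
    continuity_2d_pt a s t -> continuity_2d_pt b s t ->
    continuity_2d_pt (fun s t => a s t + k * b s t) s t).
  { intros a b s t Ha Hb. apply continuity_2d_pt_plus; [exact Ha|].
    apply continuity_2d_pt_mult; [apply continuity_2d_pt_const | exact Hb]. }
  intros [Hf Hf0] [Hg Hg0]. split.
  - intros s t Hs. destruct (Hf s t Hs) as (?&?&?), (Hg s t Hs) as (?&?&?).
    split; [|split; now apply Hc].
    apply differentiable_pt_lim_plus; [assumption|].
    now apply differentiable_pt_lim_scal.
  - intros s t. now apply (Hc (fun u v => f (Rabs u) v) (fun u v => g (Rabs u) v)).
Qed.

Lemma C1_half_time_reversal (k : R) (f fs ft : R -> R -> R) :
  C1_half f fs ft ->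
  C1_half (fun s t => k * f s (- t)) (fun s t => k * fs s (- t))
          (fun s t => - k * ft s (- t)).
Proof.
  assert (Hc : forall c (a : R -> R -> R) s t, continuity_2d_pt a s (- t) ->
    continuity_2d_pt (fun s t => c * a s (- t)) s t).
  { intros c a s t Ha.
    apply continuity_2d_pt_mult; [apply continuity_2d_pt_const|].
    intros eps. destruct (Ha eps) as [d Hd]. exists d. intros u v Hu Hv.
    apply Hd; [exact Hu|]. rewrite <- Rabs_Ropp.
    now replace (- (- v - - t)) with (v - t) by ring. }
  intros [Hf Hf0]. split.
  - intros s t Hs. destruct (Hf s (- t) Hs) as (?&?&?).
    split; [|split; now apply Hc].
    eapply differentiable_pt_lim_eq.
    + apply differentiable_pt_lim_scal.
      apply (differentiable_pt_lim_comp f (fun s _ => s) (fun _ t => - t));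
        [eassumption | apply differentiable_pt_lim_fst |].
      apply differentiable_pt_lim_ext with (fun _ t => -1 * t).
      * exists (mkposreal 1 Rlt_0_1). intros; ring.
      * apply (differentiable_pt_lim_scal (-1) (fun _ t => t)), differentiable_pt_lim_snd.
    + ring.
    + ring.
  - intros s t. apply (Hc k (fun u v => f (Rabs u) v)), Hf0.
Qed.

Lemma cg_solution_lincomb (m k : R) (psi1 phi1 psi2 phi2 : R -> R -> R) :
  cg_solution m psi1 phi1 -> cg_solution m psi2 phi2 ->
  cg_solution m (fun s t => psi1 s t + k * psi2 s t)
                (fun s t => phi1 s t + k * phi2 s t).
Proof.
  intros (ps1 & pt1 & fs1 & ft1 & P1 & F1 & E1) (ps2 & pt2 & fs2 & ft2 & P2 & F2 & E2).
  do 4 eexists. split; [|split].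
  - apply C1_half_lincomb; [exact P1 | exact P2].
  - apply C1_half_lincomb; [exact F1 | exact F2].
  - intros s t Hs. simpl. destruct (E1 s t Hs), (E2 s t Hs). split; nra.
Qed.

(** The factors 1 and -1 put both components in the form of [C1_half_time_reversal]. *)
Lemma cg_solution_time_reversal (m : R) (psi phi : R -> R -> R) :
  cg_solution m psi phi ->
  cg_solution m (fun s t => 1 * psi s (- t)) (fun s t => -1 * phi s (- t)).
Proof.
  intros (ps & pt & fs & ft & P & F & E).
  do 4 eexists. split; [|split].
  - apply C1_half_time_reversal, P.
  - apply C1_half_time_reversal, F.
  - intros s t Hs. simpl. destruct (E s (- t) Hs). split; lra.
Qed.

(* For k = 1 (resp. k = -1) the symmetrised phi (resp. psi) vanishes at time 0
   by itself. *)
Lemma cg_solution_parity (m k : R) (psi phi : R -> R -> R) :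
  0 < m -> cg_solution m psi phi ->
  (forall s, 0 < s -> (1 + k) * psi s 0 = 0 /\ (1 - k) * phi s 0 = 0) ->
  forall T, 0 <= T -> psi 0 T + k * psi 0 (- T) = 0.
Proof.
  intros Hm Hsol H0 T HT.
  assert (Hrev := cg_solution_lincomb m k _ _ _ _ Hsol (cg_solution_time_reversal _ _ _ Hsol)).
  assert (H := cg_solution_zero_data _ _ _ Hm Hrev).
  simpl in H. rewrite <- (Rmult_1_l (psi 0 (- T))). apply H; [|exact HT].
  intros s Hs. rewrite Ropp_0. destruct (H0 s Hs). split; lra.
Qed.

Theorem proposition2 (m : R) (hm : 0 < m) :
  (forall (eta u : R -> R -> R) (r : R -> R) (psi phi : R -> R -> R),
     nonbreaking_wave m eta u r psi phi ->
     forall tau : R,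
       let t := tau + phi 0 tau in
       t = tau - Derive r t /\ psi 0 tau = r t + (Derive r t) ^ 2 / 2) /\
  (forall (eta1 u1 : R -> R -> R) (r1 : R -> R) (psi1 phi1 : R -> R -> R)
          (eta2 u2 : R -> R -> R) (r2 : R -> R) (psi2 phi2 : R -> R -> R),
     nonbreaking_wave m eta1 u1 r1 psi1 phi1 ->
     nonbreaking_wave m eta2 u2 r2 psi2 phi2 ->
     ((forall sigma : R, 0 <= sigma -> psi1 sigma 0 = psi2 sigma 0) ->
      forall tau : R, even_part (psi1 0) tau = even_part (psi2 0) tau) /\
     ((forall sigma : R, 0 <= sigma -> phi1 sigma 0 = phi2 sigma 0) ->
      forall tau : R, odd_part (psi1 0) tau = odd_part (psi2 0) tau)).
Proof.
  split.
  - intros eta u r psi phi Hwave tau.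
    assert (Hvel := shoreline_velocity m eta u r psi phi).
    assert (Hparts := Hwave).
    destruct Hparts as (_ & _ & Hrun & _ & (_ & Hsurj & _) & Him & _).
    destruct (Hsurj 0 tau (Rle_refl 0)) as (x & z & Hw & Hsig & Htau).
    specialize (Hvel x z Hwave Hsig).
    destruct (Him x z Hw) as [Hphi Hpsi].
    rewrite Hsig, Htau in Hphi, Hpsi.
    assert (Hr := proj2 (Hrun z) x Hsig).
    unfold cg_tau in Htau.
    (* The time in the statement is the physical time z of the shoreline point with hodograph
       coordinates (0, tau). *)
    replace (tau + phi 0 tau) with z by lra.
    simpl. split; [lra|].
    rewrite Hpsi, Hvel, Hr. field.
  - intros eta1 u1 r1 psi1 phi1 eta2 u2 r2 psi2 phi2 W1 W2.
    (* By linearity only the difference of the two waves matters; its initial pressure or initial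
       velocity vanishes. *)
    assert (Hsol := cg_solution_lincomb m (-1) _ _ _ _
      (nonbreaking_wave_cg_solution _ _ _ _ _ _ W1)
      (nonbreaking_wave_cg_solution _ _ _ _ _ _ W2)).
    split; intros H0 tau.
    + assert (H := cg_solution_parity m 1 _ _ hm Hsol).
      simpl in H. unfold even_part.
      (* [cg_solution_parity] covers times T >= 0; for negative tau it is used at - tau, which only
         swaps the two values in the parity combination. *)
      destruct (Rle_dec 0 tau) as [Ht|Ht].
      * specialize (H ltac:(intros s Hs; rewrite (H0 s) by lra; split; lra) tau Ht). lra.
      * specialize (H ltac:(intros s Hs; rewrite (H0 s) by lra; split; lra) (- tau) ltac:(lra)).
        rewrite Ropp_involutive in H. lra.
    + assert (H := cg_solution_parity m (-1) _ _ hm Hsol).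
      simpl in H. unfold odd_part.
      destruct (Rle_dec 0 tau) as [Ht|Ht].
      * specialize (H ltac:(intros s Hs; rewrite (H0 s) by lra; split; lra) tau Ht). lra.
      * specialize (H ltac:(intros s Hs; rewrite (H0 s) by lra; split; lra) (- tau) ltac:(lra)).
        rewrite Ropp_involutive in H. lra.
Qed.
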